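(* For any integer $k \geq 3$ and any prime $p \geq 2^{32(k-1)^2\log_2^2(16(k-1))}$ there exists a subset $A \subseteq \mathbb{F}_p$ of size $|A| \leq \frac{10}{k-1}\frac{\log_{2} p}{\log_{2}\log_{2} p}$ which is not $F_k$-ring-isomorphic to any subset of any integral domain of characteristic zero.
   Context: For a polynomial $f \in \mathbb{Z}[x_1,\ldots,x_n]$, $\|f\|_1$ denotes the sum of the absolute values of its coefficients; $f$ is called $k$-bounded if $\|f\|_1 \leq k$ and $\deg f \leq k$. For rings $R_1,R_2$ and finite subsets $A\subseteq R_1$, $B\subseteq R_2$, a bijection $\phi: A\to B$ is an $F_k$-ring-isomorphism if, writing $A=\{a_1,\ldots,a_n\}$, for every $k$-bounded $f\in\mathbb{Z}[x_1,\ldots,x_n]$ we have $f(a_1,\ldots,a_n)=0$ if and only if $f(\phi(a_1),\ldots,\phi(a_n))=0$. A set $A$ is $F_k$-ring-isomorphic to $B$ if such a bijection exists. *)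

(* Defs.v *)
From HB Require Import structures.
From mathcomp Require Import all_boot all_order all_algebra finmap.
From mathcomp Require Import mpoly.
From mathcomp Require Import reals exp.

Set Implicit Arguments.
Unset Strict Implicit.
Unset Printing Implicit Defensive.

Import GRing.Theory Num.Theory.
Local Open Scope ring_scope.

Definition log2 (R : realType) (x : R) : R := ln x / ln 2.

Definition mnorm1 (n : nat) (f : {mpoly int[n]}) : int :=
  \sum_(m <- msupp f) `|f@_m|.

(* [msize f] is the total degree plus one, and [msize 0 = 0]. *)
Definition bounded_mpoly (k n : nat) (f : {mpoly int[n]}) : Prop :=
  mnorm1 f <= k%:Z /\ (msize f <= k.+1)%N.

Definition zeval (R : comNzRingType) (n : nat) (v : 'I_n -> R)
    (f : {mpoly int[n]}) : R :=
  mmap intr v f.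

(* The elements of A are listed as [enum_val i]; since boundedness is invariant
   under permuting the variables, the choice of the listing is immaterial. *)
Definition Fk_ring_isomorphism (k : nat) (R1 R2 : comNzRingType)
    (A : {fset R1}) (B : {fset R2}) (phi : A -> B) : Prop :=
  bijective phi /\
  forall f : {mpoly int[#|{: A}|]}, bounded_mpoly k f ->
    (zeval (fun i => val (enum_val i : A)) f = 0 <->
     zeval (fun i => val (phi (enum_val i))) f = 0).

Definition Fk_ring_isomorphic (k : nat) (R1 R2 : comNzRingType)
    (A : {fset R1}) (B : {fset R2}) : Prop :=
  exists phi : A -> B, Fk_ring_isomorphism k phi.

(* Main.v *)
Require Import Defs.
From HB Require Import structures.
From mathcomp Require Import all_boot all_order all_algebra finmap.
From mathcomp Require Import ssrcomplements mpoly.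
From mathcomp Require Import reals exp.
From mathcomp Require Import zify ring lra.

Set Implicit Arguments.
Unset Strict Implicit.
Unset Printing Implicit Defensive.

Import Order.TTheory GRing.Theory Num.Theory.
Local Open Scope ring_scope.

(* Put L = log2 p, b = floor(sqrt L) + 1 and B = b ^ (k - 2), and let A consist
   of the residues of 1, ..., b and of the quotients p %/ B ^ j.  Given an
   isomorphism phi from A, look at the N for which some integer polynomial of
   norm c and degree d takes the value N both at the elements of A and at their
   images under phi.  If c < k, d <= k and the residue of N lies in A, the
   relation x = f shows that phi sends this residue to N, so that c and d drop
   to 1.  The constant 1 and m + 1 = (m) + 1 thus give all of 1, ..., b.  The
   expansion in base b,
     N = (N %/ B) * b ^ (k - 2) + \sum_(i < k - 2) d_i * b ^ i,
   has norm and degree k - 1 in N %/ B, b and the digits d_i.  So, from the last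
   quotient (which vanishes) to the first, phi sends every p %/ B ^ j to itself;
   for N = p the expansion is 0 in 'F_p, hence p = 0 in the target ring.  There
   are about L / log2 B quotients, which together with the b <= sqrt L + 1 small
   residues gives the bound on the size of A. *)

Section Norm1.
Variable n : nat.
Implicit Types (f g : {mpoly int[n]}) (m : 'X_{1..n}) (c : int) (d : nat).

Lemma mnorm1_wide d f : (msize f <= d)%N ->
  mnorm1 f = \sum_(m : 'X_{1..n < d}) `|f@_m|.
Proof.
move=> f_size; rewrite /mnorm1 (big_mksub 'X_{1..n < d}) ?msupp_uniq //=.
  by rewrite big_rmcond //= => m /memN_msupp_eq0 ->; rewrite normr0.
by move=> m /msize_mdeg_lt /leq_trans; apply.
Qed.

Lemma mnorm1_0 : mnorm1 (0 : {mpoly int[n]}) = 0.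
Proof. by rewrite /mnorm1 msupp0 big_nil. Qed.

Lemma mnorm1N f : mnorm1 (- f) = mnorm1 f.
Proof.
rewrite !(@mnorm1_wide (msize f)) ?msizeN //.
by apply: eq_bigr => m _; rewrite mcoeffN normrN.
Qed.

Lemma mnorm1D_le f g : mnorm1 (f + g) <= mnorm1 f + mnorm1 g.
Proof.
rewrite !(@mnorm1_wide (maxn (msize f) (msize g))) ?leq_maxl ?leq_maxr //.
  by rewrite -big_split; apply: ler_sum => m _; rewrite mcoeffD ler_normD.
exact: msizeD_le.
Qed.

Lemma mnorm1ZX c m : mnorm1 (c *: 'X_[m]) = `|c|.
Proof.
have [->|c_neq0] := eqVneq c 0; first by rewrite scale0r mnorm1_0 normr0.
by rewrite /mnorm1 msuppMCX // big_seq1 mcoeffZ mcoeffX eqxx mulr1.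
Qed.

Lemma mnorm1X m : mnorm1 ('X_[m] : {mpoly int[n]}) = 1.
Proof. by rewrite -['X_[m]]scale1r mnorm1ZX normr1. Qed.

Lemma mnorm1C c : mnorm1 (c%:MP : {mpoly int[n]}) = `|c|.
Proof. by rewrite -[c%:MP]mulr1 mul_mpolyC -mpolyX0 mnorm1ZX. Qed.

Lemma mnorm1_sum_le (I : Type) (r : seq I) (F : I -> {mpoly int[n]}) :
  mnorm1 (\sum_(i <- r) F i) <= \sum_(i <- r) mnorm1 (F i).
Proof.
elim/big_ind2: _ => // [|x f y g fx gy]; first by rewrite mnorm1_0.
by apply: le_trans (mnorm1D_le f g) _; exact: lerD.
Qed.

Lemma mnorm1M_le f g : mnorm1 (f * g) <= mnorm1 f * mnorm1 g.
Proof.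
rewrite mpolyME; apply: le_trans (mnorm1_sum_le _ _) _.
rewrite big_allpairs mulr_suml; apply: ler_sum => m _; rewrite mulr_sumr.
by apply: ler_sum => m' _; rewrite mnorm1ZX normrM.
Qed.

End Norm1.

Lemma msizeM_leD (R : idomainType) (n d e : nat) (f g : {mpoly R[n]}) :
  (msize f <= d.+1)%N -> (msize g <= e.+1)%N -> (msize (f * g) <= (d + e).+1)%N.
Proof.
move=> f_size g_size.
have [->|f_neq0] := eqVneq f 0; first by rewrite mul0r msize0.
have [->|g_neq0] := eqVneq g 0; first by rewrite mulr0 msize0.
by rewrite msizeM //; lia.
Qed.

HB.instance Definition _ (R : comNzRingType) (n : nat) (v : 'I_n -> R) :=
  GRing.RMorphism.copy (zeval v) (mmap intr v).

Lemma zevalU (R : comNzRingType) (n : nat) (v : 'I_n -> R) (i : 'I_n) :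
  zeval v 'X_i = v i.
Proof. by rewrite /zeval mmapX mmap1U. Qed.

Section CommonValues.
Variables (n : nat) (R1 R2 : comNzRingType).
Variables (v1 : 'I_n -> R1) (v2 : 'I_n -> R2).
Implicit Types (c d k : nat) (M N b r : nat).

Definition same_relations k : Prop :=
  forall f : {mpoly int[n]}, bounded_mpoly k f ->
    zeval v1 f = 0 <-> zeval v2 f = 0.

Definition common_value c d N : Prop :=
  exists f : {mpoly int[n]}, [/\ mnorm1 f <= c%:Z, (msize f <= d.+1)%N,
    zeval v1 f = N%:R & zeval v2 f = N%:R].

Lemma common_value_le c c' d d' N : (c <= c')%N -> (d <= d')%N ->
  common_value c d N -> common_value c' d' N.
Proof.
move=> le_c le_d [f [f_norm f_size f1 f2]]; exists f; split=> //.
  by apply: le_trans f_norm _; rewrite lez_nat.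
exact: leq_trans f_size _.
Qed.

Lemma common_value_nat N : common_value N 0 N.
Proof.
exists N%:R; split; rewrite ?rmorph_nat //.
  by rewrite -mpolyC_nat mnorm1C normr_nat natz.
by rewrite -mpolyC_nat msizeC leq_b1.
Qed.

Lemma common_valueD c c' d M N :
  common_value c d M -> common_value c' d N -> common_value (c + c') d (M + N).
Proof.
move=> [f [f_norm f_size f1 f2]] [g [g_norm g_size g1 g2]].
exists (f + g); split.
- by apply: le_trans (mnorm1D_le f g) _; rewrite PoszD lerD.
- by apply: leq_trans (msizeD_le f g) _; rewrite geq_max f_size.
- by rewrite rmorphD natrD /= f1 g1.
- by rewrite rmorphD natrD /= f2 g2.
Qed.

Lemma common_valueM c c' d d' M N :
  common_value c d M -> common_value c' d' N ->
  common_value (c * c') (d + d') (M * N).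
Proof.
move=> [f [f_norm f_size f1 f2]] [g [g_norm g_size g1 g2]].
exists (f * g); split.
- apply: le_trans (mnorm1M_le f g) _; rewrite PoszM.
  by apply: ler_pM => //; exact: sumr_ge0.
- exact: msizeM_leD.
- by rewrite rmorphM natrM /= f1 g1.
- by rewrite rmorphM natrM /= f2 g2.
Qed.

Lemma common_value_coord k c d N (i : 'I_n) :
  same_relations k -> (c < k)%N -> (d <= k)%N ->
  common_value c d N -> v1 i = N%:R -> common_value 1 1 N.
Proof.
move=> same c_lt d_le [f [f_norm f_size f1 f2]] v1i.
have zevalUB (R : comNzRingType) (v : 'I_n -> R) :
    zeval v ('X_i - f) = v i - zeval v f by rewrite rmorphB /= zevalU.
(* ['X_i - f] is a [k]-bounded relation at [v1], hence also at [v2]. *)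
exists 'X_i; rewrite mnorm1X msizeX mdeg1 !zevalU; split=> //.
apply/eqP; rewrite -subr_eq0 -f2 -zevalUB; apply/eqP/same.
  split.
    by apply: le_trans (mnorm1D_le _ _) _; rewrite mnorm1N mnorm1X; lia.
  apply: leq_trans (msizeD_le _ _) _.
  by rewrite msizeN msizeX mdeg1 geq_max; lia.
by rewrite zevalUB f1 v1i subrr.
Qed.

Lemma common_value_natr_eq0 k N : same_relations k -> common_value k k N ->
  N%:R = 0 :> R1 <-> N%:R = 0 :> R2.
Proof. by move=> same [f [f_norm f_size <- <-]]; exact: same. Qed.

Lemma common_value_interval k b :
  same_relations k -> (3 <= k)%N ->
  (forall m, (0 < m <= b)%N -> m%:R \in codom v1) ->
  forall m, (m <= b)%N -> common_value 1 1 m.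
Proof.
move=> same k_ge3 m_in; elim=> [_|m IHm m_lt].
  exact: common_value_le (common_value_nat 0).
have /codomP[i /esym v1i] : m.+1%:R \in codom v1 by exact: m_in.
apply: (@common_value_coord k 2 1 m.+1 i) => //; first by lia.
rewrite -addn1 -[m.+1]addn1; apply: common_valueD; first exact/IHm/ltnW.
exact: common_value_le (common_value_nat 1).
Qed.

Section Base.
Variable b : nat.
Hypothesis b_gt0 : (0 < b)%N.
Hypothesis small_values : forall m, (m <= b)%N -> common_value 1 1 m.

Lemma common_value_digits r N :
  common_value 1 1 (N %/ b ^ r) -> common_value r.+1 r.+1 N.
Proof.
elim: r N => [|r IHr] N; first by rewrite divn1.
rewrite expnS divnMA => /IHr Nb; rewrite (divn_eq N b).
apply: (@common_value_le (r.+1 * 1 + 1) _ (r.+1 + 1)); [lia | lia |].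
apply: common_valueD; first exact: common_valueM Nb (small_values (leqnn b)).
exact: common_value_le (small_values (ltnW (ltn_pmod N b_gt0))).
Qed.

Lemma common_value_divn k r J N :
  same_relations k -> (r.+2 <= k)%N ->
  (forall j, (0 < j <= J)%N -> (N %/ (b ^ r) ^ j)%:R \in codom v1) ->
  (N < (b ^ r) ^ J.+1)%N -> common_value 1 1 (N %/ b ^ r).
Proof.
move=> same r_le; elim: J N => [|J IHJ] N quotient_in N_lt.
  by rewrite divn_small //; exact: small_values.
have /codomP[i /esym v1i] : (N %/ b ^ r)%:R \in codom v1.
  by rewrite -[(b ^ r)%N]expn1; exact: quotient_in.
apply: (@common_value_coord k r.+1 r.+1 _ i) => //; first by lia.
apply: common_value_digits; apply: IHJ.
  by move=> j /andP[_ j_le]; rewrite -divnMA -expnS; exact: quotient_in.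
by rewrite ltn_divLR ?expn_gt0 ?b_gt0 // -expnSr.
Qed.

End Base.

Lemma natr_eq0_same_relations k b r J N :
  same_relations k -> (0 < b)%N -> (0 < r)%N -> (r.+2 <= k)%N ->
  (forall m, (0 < m <= b)%N -> m%:R \in codom v1) ->
  (forall j, (0 < j <= J)%N -> (N %/ (b ^ r) ^ j)%:R \in codom v1) ->
  (N < (b ^ r) ^ J.+1)%N ->
  N%:R = 0 :> R1 <-> N%:R = 0 :> R2.
Proof.
move=> same b_gt0 r_gt0 r_le small_in quotient_in N_lt.
have small_values : forall m, (m <= b)%N -> common_value 1 1 m.
  by apply: common_value_interval same _ small_in; lia.
apply: (common_value_natr_eq0 same).
apply: (@common_value_le r.+1 _ r.+1); [lia | lia |].
apply: (common_value_digits b_gt0 small_values).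
exact: (common_value_divn b_gt0 small_values same r_le quotient_in N_lt).
Qed.

End CommonValues.

Lemma expn_gt1 (b r : nat) : (1 < b)%N -> (0 < r)%N -> (1 < b ^ r)%N.
Proof. by move=> b_gt1 r_gt0; rewrite -{1}(exp1n r) ltn_exp2r. Qed.

Definition digit_seq (N b r : nat) : seq nat :=
  iota 1 b ++
  [seq (N %/ (b ^ r) ^ j)%N | j <- iota 1 (trunc_log (b ^ r) N)].

Definition digit_fset (R : nzRingType) (N b r : nat) : {fset R} :=
  [fset x in [seq m%:R | m <- digit_seq N b r]]%fset.

Lemma card_digit_fset (R : nzRingType) (N b r : nat) :
  (#|` digit_fset R N b r| <= b + trunc_log (b ^ r) N)%N.
Proof.
rewrite card_fseq (leq_trans (size_undup _)) // size_map size_cat size_map.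
by rewrite !size_iota.
Qed.

Lemma digit_fset_natr_eq0 (R1 R2 : comNzRingType) (N b r k : nat)
    (B : {fset R2}) :
  (1 < b)%N -> (0 < r)%N -> (r.+2 <= k)%N ->
  Fk_ring_isomorphic k (digit_fset R1 N b r) B ->
  N%:R = 0 :> R1 <-> N%:R = 0 :> R2.
Proof.
set A := digit_fset R1 N b r => b_gt1 r_gt0 r_le [phi [_ same]].
have mem_codom (m : nat) : m \in digit_seq N b r ->
    m%:R \in codom (fun i : 'I_#|{: A}| => val (enum_val i)).
  move=> m_in; have m_inA : m%:R \in A by rewrite inE; exact: map_f.
  by apply/codomP; exists (enum_rank [` m_inA]%fset); rewrite enum_rankK.
apply: (natr_eq0_same_relations same (ltnW b_gt1) r_gt0 r_le).
- move=> m m_range; apply: mem_codom.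
  by rewrite mem_cat mem_iota add1n ltnS m_range.
- move=> j j_range; apply: mem_codom; rewrite mem_cat; apply/orP; right.
  by apply: map_f; rewrite mem_iota add1n ltnS j_range.
- by apply: trunc_log_ltn; exact: expn_gt1.
Qed.

Section Log2.
Variable R : realType.
Implicit Types x y a m L : R.

Lemma ln2_gt0 : 0 < ln 2 :> R.
Proof. by apply: ln_gt0; lra. Qed.

Lemma ln2_ge_half : 2^-1 <= ln 2 :> R.
Proof.
have := @le_ln1Dx R (- 2^-1); rewrite (_ : 1 + - 2^-1 = 2^-1 :> R); last by lra.
by rewrite lnV ?posrE // lerN2; apply; lra.
Qed.

Lemma log2_2 : log2 2 = 1 :> R.
Proof. by rewrite /log2 divff // gt_eqF ?ln2_gt0. Qed.

Lemma log2M x y : 0 < x -> 0 < y -> log2 (x * y) = log2 x + log2 y.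
Proof. by move=> x_gt0 y_gt0; rewrite /log2 lnM ?posrE // mulrDl. Qed.

Lemma log2X x (n : nat) : 0 < x -> log2 (x ^+ n) = n%:R * log2 x.
Proof. by move=> x_gt0; rewrite /log2 lnXn // [RHS]mulr_natl mulrnAl. Qed.

Lemma log2_sqrt x : 0 < x -> log2 x = 2 * log2 (Num.sqrt x).
Proof. by move=> x_gt0; rewrite -log2X ?sqrtr_gt0 // sqr_sqrtr // ltW. Qed.

Lemma ler_log2 x y : 0 < x -> x <= y -> log2 x <= log2 y.
Proof.
move=> x_gt0 le_xy; rewrite /log2 ler_pM2r ?invr_gt0 ?ln2_gt0 //.
by rewrite ler_ln ?posrE // (lt_le_trans x_gt0).
Qed.

Lemma log2_ge1 x : 2 <= x -> 1 <= log2 x.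
Proof. by move=> x_ge2; rewrite -log2_2 ler_log2. Qed.

Lemma log2_le_double x : 0 < x -> log2 x <= 2 * x.
Proof.
move=> x_gt0; rewrite /log2 ler_pdivrMr ?ln2_gt0 //.
have := ln_sublinear x_gt0; have := ln2_ge_half; nra.
Qed.

Lemma log2_le_affine a x : 0 < a -> 0 < x -> log2 x <= log2 a + 2 * (x / a).
Proof.
move=> a_gt0 x_gt0; have xa_gt0 : 0 < x / a by exact: divr_gt0.
rewrite -[in leLHS](divfK (lt0r_neq0 a_gt0) x) mulrC log2M // lerD2l.
exact: log2_le_double.
Qed.

Lemma powR2_le_log2 x y : 2 `^ x <= y -> x <= log2 y.
Proof.
move=> le_xy; have y_gt0 : 0 < y by rewrite (lt_le_trans _ le_xy) // powR_gt0.
rewrite /log2 ler_pdivlMr ?ln2_gt0 // -ln_powR ler_ln ?posrE //.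
exact: powR_gt0.
Qed.

Lemma trunc_log_mul_log2_le (b n : nat) : (1 < b)%N -> (0 < n)%N ->
  (trunc_log b n)%:R * log2 b%:R <= log2 n%:R :> R.
Proof.
move=> b_gt1 n_gt0; have b_gt0 : 0 < b%:R :> R by rewrite ltr0n ltnW.
rewrite -log2X //; apply: ler_log2; first exact: exprn_gt0.
by rewrite -natrX ler_nat trunc_logP.
Qed.

Lemma five_mul_log2_le_sqrt m L : 2 <= m ->
  32 * m ^+ 2 * log2 (16 * m) ^+ 2 <= L ->
  5 * (m * log2 (16 * m)) <= Num.sqrt L.
Proof.
move=> m_ge2 le_L; have t_ge1 : 1 <= log2 (16 * m) by apply: log2_ge1; lra.
have mt_ge0 : 0 <= 5 * (m * log2 (16 * m)).
  by apply: mulr_ge0 => //; apply: mulr_ge0; lra.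
rewrite -(ger0_norm mt_ge0) -sqrtr_sqr; apply: ler_wsqrtr.
apply: le_trans le_L; rewrite -[leRHS]mulrA -[in leRHS]exprMn [leLHS]exprMn.
by rewrite ler_wpM2r ?sqr_ge0 //; lra.
Qed.

Lemma mul_log2_sqr_le m x : 0 < m -> 0 < x ->
  5 * (m * log2 (16 * m)) <= x -> m * log2 (x ^+ 2) <= x.
Proof.
move=> m_gt0 x_gt0 mt_le; have m16_gt0 : 0 < 16 * m by exact: mulr_gt0.
have mlog_le : m * log2 x <= m * (log2 (16 * m) + 2 * (x / (16 * m))).
  by rewrite ler_pM2l //; exact: log2_le_affine.
have mdivE : m * (2 * (x / (16 * m))) = x / 8 by field; exact: lt0r_neq0.
by rewrite mulrDr mdivE in mlog_le; rewrite log2X //; lra.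
Qed.

Lemma mul_log2_le_sqrt m L : 2 <= m ->
  32 * m ^+ 2 * log2 (16 * m) ^+ 2 <= L ->
  2 < Num.sqrt L /\ m * log2 L <= Num.sqrt L.
Proof.
move=> m_ge2 le_L; have mt_le := five_mul_log2_le_sqrt m_ge2 le_L.
have t_ge1 : 1 <= log2 (16 * m) by apply: log2_ge1; lra.
have s_gt2 : 2 < Num.sqrt L by nra.
have L_gt0 : 0 < L by rewrite -sqrtr_gt0; lra.
split=> //; rewrite -{1}(sqr_sqrtr (ltW L_gt0)).
by apply: mul_log2_sqr_le => //; lra.
Qed.

Definition sqrt_base L : nat := (Num.truncn (Num.sqrt L)).+1.

Lemma sqrt_lt_base L : Num.sqrt L < (sqrt_base L)%:R.
Proof. exact: truncnS_gt. Qed.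

Lemma sqrt_base_le L : (sqrt_base L)%:R <= Num.sqrt L + 1.
Proof. by rewrite -natr1 lerD2r truncn_le sqrtr_ge0. Qed.

Lemma sqrt_base_mul_le L y : 1 <= L -> 0 <= y <= Num.sqrt L ->
  (sqrt_base L)%:R * y <= 2 * L.
Proof.
move=> L_ge1 /andP[y_ge0 y_le]; set s := Num.sqrt L in y_le *.
have s_ge1 : 1 <= s by rewrite -sqrtr1 ler_wsqrtr.
have sE : s * s = L by rewrite -expr2 sqr_sqrtr //; lra.
have base_le : (sqrt_base L)%:R <= 2 * s.
  by apply: le_trans (sqrt_base_le L) _; rewrite -/s; lra.
by apply: le_trans (ler_pM _ _ base_le y_le) _; rewrite // -mulrA sE.
Qed.

Lemma trunc_log_expn_mul_log2_log2_le (b r n : nat) :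
  (1 < b)%N -> (0 < r)%N -> (1 < n)%N -> Num.sqrt (log2 n%:R) <= b%:R :> R ->
  (trunc_log (b ^ r) n)%:R * (r%:R * log2 (log2 n%:R)) <= 2 * log2 n%:R :> R.
Proof.
move=> b_gt1 r_gt0 n_gt1 sqrt_le; set L : R := log2 n%:R.
have L_gt0 : 0 < L by apply: lt_le_trans (log2_ge1 _); rewrite ?ler_nat.
have logL_le : log2 L <= 2 * log2 b%:R.
  by rewrite log2_sqrt // ler_pM2l // ler_log2 ?sqrtr_gt0.
apply: le_trans (_ : _ * (r%:R * (2 * log2 b%:R)) <= _).
  by apply: ler_wpM2l => //; exact: ler_wpM2l.
rewrite [X in _ * X <= _]mulrCA [leLHS]mulrCA ler_pM2l //.
rewrite -log2X ?ltr0n ?(ltnW b_gt1) // -natrX.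
by apply: trunc_log_mul_log2_le; [exact: expn_gt1 | exact: ltnW].
Qed.

Lemma base_add_trunc_log_le (k p : nat) L :
  (3 <= k)%N -> (1 < p)%N -> log2 p%:R = L ->
  32 * (k%:R - 1) ^+ 2 * log2 (16 * (k%:R - 1)) ^+ 2 <= L ->
  (1 < sqrt_base L)%N /\
  (sqrt_base L + trunc_log (sqrt_base L ^ (k - 2)) p)%:R
    <= 10 / (k%:R - 1) * (L / log2 L).
Proof.
move=> k_ge3 p_gt1 log2p.
have r_gt0 : (0 < k - 2)%N by lia.
have m_ge2 : 2 <= k%:R - 1 :> R by rewrite lerBrDr natr1 ler_nat.
have m_le : k%:R - 1 <= 2 * (k - 2)%:R :> R.
  by rewrite lerBlDr -natrM natr1 ler_nat; lia.
move: (k%:R - 1) m_ge2 m_le => m m_ge2 m_le L_large.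
have [s_gt2 mlog_le] := mul_log2_le_sqrt m_ge2 L_large.
have L_gt0 : 0 < L by rewrite -sqrtr_gt0; lra.
have L_ge2 : 2 <= L by rewrite -(sqr_sqrtr (ltW L_gt0)); nra.
have logL_ge1 := log2_ge1 L_ge2.
have mlog_gt0 : 0 < m * log2 L by apply: mulr_gt0; lra.
have lt_b := sqrt_lt_base L.
have b_gt1 : (1 < sqrt_base L)%N by rewrite -(ltr_nat R); lra.
split=> //; rewrite mulf_div ler_pdivlMr // natrD mulrDl.
have b_le : (sqrt_base L)%:R * (m * log2 L) <= 2 * L.
  by apply: sqrt_base_mul_le; [lra | rewrite mlog_le ltW].
have J_le : (trunc_log (sqrt_base L ^ (k - 2)) p)%:R * (m * log2 L) <= 4 * L.
  have := @trunc_log_expn_mul_log2_log2_le _ (k - 2) p b_gt1 r_gt0 p_gt1.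
  rewrite log2p => /(_ (ltW lt_b)) J_expn_le.
  apply: le_trans (_ : _ * (2 * (k - 2)%:R * log2 L) <= _).
    by apply: ler_wpM2l => //; apply: ler_wpM2r => //; lra.
  rewrite -[2 * _ * _]mulrA [leLHS]mulrCA (natrM _ 2 2) -[leRHS]mulrA.
  by rewrite ler_pM2l.
by apply: le_trans (lerD b_le J_le) _; lra.
Qed.

End Log2.

Theorem theorem1p4 (R : realType) (k p : nat)
    (k_ge3 : (3 <= k)%N) (p_prime : prime p)
    (p_large : 2 `^ (32 * (k%:R - 1) ^+ 2 * log2 (16 * (k%:R - 1)) ^+ 2)
               <= p%:R :> R) :
  exists A : {fset 'F_p},
    (#|` A|%:R <= 10 / (k%:R - 1) * (log2 p%:R / log2 (log2 p%:R)) :> R) /\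
    forall (D : idomainType), [pchar D] =i pred0 ->
      forall B : {fset D}, ~ Fk_ring_isomorphic k A B.
Proof.
have [b_gt1 size_le] := base_add_trunc_log_le k_ge3 (prime_gt1 p_prime) erefl
  (powR2_le_log2 p_large).
set b := sqrt_base _ in b_gt1 size_le.
exists (digit_fset 'F_p p b (k - 2)); split.
  by apply: le_trans size_le; rewrite ler_nat card_digit_fset.
move=> D D_char0 B iso.
have r_gt0 : (0 < k - 2)%N by lia.
have r_le : ((k - 2).+2 <= k)%N by lia.
have /proj1/(_ (pchar_Fp_0 p_prime)) p_eq0 :=
  digit_fset_natr_eq0 b_gt1 r_gt0 r_le iso.
by have := D_char0 p; rewrite !inE p_prime p_eq0 eqxx.
Qed.
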